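(* Put $C:=4(1+e^{\sqrt3})^2e^{\sqrt3}$ and, for $x=(x^1,\dots,x^n)\in\mathbb R^n$, $$\psi(x)=\sum_{j=1}^n\left(\log\frac1{1+(x^j)^2}+C\log(1+e^{x^j})\right).$$ Then $\psi$ is strictly convex on $\mathbb R^n$ and $\nabla\psi(\mathbb R^n)\subset(-1,C+1)^n$. Moreover, if $\psi$ is regarded as a function on $\mathbb R^n\times\mathbb T^n$, then $dd^c\psi$ is complete Kähler on $\mathbb R^n\times\mathbb T^n$.
   Context: A smooth function is strictly convex if its Hessian matrix is positive definite at every point. $\mathbb T:=\mathbb R/\mathbb Z$, and $\mathbb R^n\times\mathbb T^n=\mathbb C^n/i\mathbb Z^n$ with complex coordinates $z^j=x^j+iy^j$; $\psi$ is regarded as a function there by $\psi(x+iy):=\psi(x)$. $d^c:=i\bar\partial-i\partial$, so $dd^c=2i\partial\bar\partial$. A Hermitian manifold $(X,\hat\omega)$ is complete if there exists a smooth function $\rho:X\to[0,\infty)$ such that $\rho^{-1}([0,c])$ is compact for every $c>0$ and $|d\rho|_{\hat\omega}\le1$ on $X$; ''$dd^c\psi$ is complete Kähler'' means that $dd^c\psi$ is a Kähler form whose associated Hermitian metric is complete. *)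

(* Defs.v *)
From HB Require Import structures.
From mathcomp Require Import all_boot all_order all_algebra.
From mathcomp Require Import complex.
From mathcomp Require Import all_classical all_reals all_analysis.

Set Implicit Arguments.
Unset Strict Implicit.
Unset Printing Implicit Defensive.

Import Order.TTheory GRing.Theory Num.Theory.
Import numFieldNormedType.Exports.

Local Open Scope classical_set_scope.
Local Open Scope ring_scope.
Local Open Scope quotient_scope.

Section Smooth.
Variables (R : realType) (V : normedModType R).

Fixpoint Ck (k : nat) (f : V -> R) : Prop :=
  if k is k'.+1 then
    (forall p, differentiable f p) /\ (forall v, Ck k' (fun p => 'D_v f p))
  else continuous f.

(* Only meaningful for finite-dimensional V, the only case used below. *)
Definition smooth (f : V -> R) : Prop := forall k, Ck k f.

End Smooth.

Section Euclidean.
Variables (R : realType) (n : nat).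

Definition basis (j : 'I_n) : 'rV[R]_n := delta_mx 0 j.

Definition gradient (f : 'rV[R]_n -> R) (x : 'rV[R]_n) : 'rV[R]_n :=
  \row_j 'D_(basis j) f x.

Definition hessian (f : 'rV[R]_n -> R) (x : 'rV[R]_n) : 'M[R]_n :=
  \matrix_(i, j) 'D_(basis i) (fun y => 'D_(basis j) f y) x.

Definition posdefmx (A : 'M[R]_n) : Prop :=
  A^T = A /\ forall v : 'rV[R]_n, v != 0 -> 0 < (v *m A *m v^T) 0 0.

Definition strictly_convex (f : 'rV[R]_n -> R) : Prop :=
  smooth f /\ forall x, posdefmx (hessian f x).

End Euclidean.

Section Cylinder.
Variables (R : realType) (n : nat).

(* C^n as a real vector space: (x, y) stands for x + iy. *)
Definition Cn := ('rV[R]_n * 'rV[R]_n)%type.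

Definition lattice_rel : rel Cn := fun p q =>
  `[< exists k : 'rV[int]_n, q - p = (0, map_mx intr k) >].

Lemma lattice_rel_equiv : equiv_class_of lattice_rel.
Proof.
split.
- move=> p; apply/asboolP; exists 0.
  by rewrite subrr; congr (_, _); apply/matrixP => i j; rewrite !mxE.
- suff S p q : lattice_rel p q -> lattice_rel q p.
    by move=> p q; apply/idP/idP; exact: S.
  move=> /asboolP[k pq]; apply/asboolP; exists (- k).
  rewrite -opprB pq; congr (_, _); first by rewrite /= oppr0.
  by apply/matrixP => i j; rewrite !mxE rmorphN.
- move=> q p r /asboolP[k pq] /asboolP[l qr]; apply/asboolP; exists (k + l).
  rewrite -(subrKA q) pq addrC qr.
  congr (_, _); first by rewrite /= addr0.
  by apply/matrixP => i j; rewrite !mxE rmorphD.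
Qed.

Canonical lattice_equiv := EquivRelPack lattice_rel_equiv.

(* C^n / iZ^n with the quotient topology, i.e. R^n x T^n. *)
Definition cylinder := quotient_topology {eq_quot lattice_equiv}.

Definition proj (p : Cn) : cylinder := \pi_cylinder p.

Definition real_part (p : cylinder) : 'rV[R]_n := (repr p).1.

Lemma real_part_proj (p : Cn) : real_part (proj p) = p.1.
Proof.
have /eqmodP/asboolP[k] : p = repr (proj p) %[mod {eq_quot lattice_equiv}].
  by rewrite reprK.
by move/(congr1 fst) => /= /eqP; rewrite subr_eq0 => /eqP.
Qed.

(* proj is a local diffeomorphism: the smooth structure of the cylinder is the
   one for which f is smooth iff f \o proj is, and proj trivializes the tangent
   bundle, so that tangent vectors are elements of Cn and differential forms are
   determined by their values on the constant vector fields. *)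
Definition smooth_cyl (f : cylinder -> R) : Prop := smooth (f \o proj).

(* Derivative along the constant field u; as f \o proj is periodic the choice
   of representative is irrelevant. *)
Definition dir (u : Cn) (f : cylinder -> R) (p : cylinder) : R :=
  'D_u (f \o proj) (repr p).

Definition dirC (u : Cn) (f : cylinder -> R[i]) (p : cylinder) : R[i] :=
  (dir u (fun q => complex.Re (f q)) p +i* dir u (fun q => complex.Im (f q)) p)%C.

Definition form1 := cylinder -> Cn -> R[i].
Definition form2 := cylinder -> Cn -> Cn -> R[i].
Definition form3 := cylinder -> Cn -> Cn -> Cn -> R[i].

Definition dz (j : 'I_n) (u : Cn) : R[i] := (u.1 0 j +i* u.2 0 j)%C.
Definition dzbar (j : 'I_n) (u : Cn) : R[i] := (u.1 0 j -i* u.2 0 j)%C.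

Definition d_dx (j : 'I_n) (f : cylinder -> R[i]) : cylinder -> R[i] :=
  dirC (basis R j, 0) f.
Definition d_dy (j : 'I_n) (f : cylinder -> R[i]) : cylinder -> R[i] :=
  dirC (0, basis R j) f.
Definition d_dz (j : 'I_n) (f : cylinder -> R[i]) (p : cylinder) : R[i] :=
  2^-1 * (d_dx j f p - 'i%C * d_dy j f p).
Definition d_dzbar (j : 'I_n) (f : cylinder -> R[i]) (p : cylinder) : R[i] :=
  2^-1 * (d_dx j f p + 'i%C * d_dy j f p).

Definition partial (f : cylinder -> R[i]) : form1 := fun p u =>
  \sum_(j < n) d_dz j f p * dz j u.
Definition partialbar (f : cylinder -> R[i]) : form1 := fun p u =>
  \sum_(j < n) d_dzbar j f p * dzbar j u.

Definition dc (f : cylinder -> R[i]) : form1 := fun p u =>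
  'i%C * partialbar f p u - 'i%C * partial f p u.

(* Exterior derivatives evaluated on constant vector fields, whose Lie brackets
   vanish. *)
Definition ext_d1 (a : form1) : form2 := fun p u v =>
  dirC u (fun q => a q v) p - dirC v (fun q => a q u) p.
Definition ext_d2 (w : form2) : form3 := fun p u v t =>
  dirC u (fun q => w q v t) p - dirC v (fun q => w q u t) p
  + dirC t (fun q => w q u v) p.

Definition ddc (f : cylinder -> R) : form2 := ext_d1 (dc (fun p => (f p)%:C%C)).

(* Multiplication by i. *)
Definition J (u : Cn) : Cn := (- u.2, u.1).

Definition smooth_form2 (w : form2) : Prop := forall u v,
  smooth_cyl (fun p => complex.Re (w p u v)) /\
  smooth_cyl (fun p => complex.Im (w p u v)).

Definition alternating2 (w : form2) : Prop := forall p,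
  (forall (a : R) u u' v,
     w p (a *: u + u') v = a%:C%C * w p u v + w p u' v) /\
  (forall u v, w p u v = - w p v u).

Definition real_form2 (w : form2) : Prop :=
  forall p u v, complex.Im (w p u v) = 0.

Definition type11 (w : form2) : Prop :=
  forall p u v, w p (J u) (J v) = w p u v.

(* The Riemannian metric g = w(., J .); other normalizations differ by a constant
   factor, which does not affect completeness. *)
Definition metric (w : form2) (p : cylinder) (u v : Cn) : R :=
  complex.Re (w p u (J v)).

Definition hermitian_form (w : form2) : Prop :=
  [/\ smooth_form2 w, alternating2 w, real_form2 w, type11 w &
      forall p u, u != 0 -> 0 < metric w p u u].

Definition kahler (w : form2) : Prop :=
  hermitian_form w /\ forall p u v t, ext_d2 w p u v t = 0.

(* Norm dual to the metric, extended-real valued so that the supremum has no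
   default value. *)
Definition conorm (w : form2) (p : cylinder) (a : Cn -> R) : \bar R :=
  ereal_sup [set `|a u|%:E | u in [set u | metric w p u u <= 1]].

Definition complete_metric (w : form2) : Prop :=
  exists rho : cylinder -> R,
    [/\ forall p, 0 <= rho p,
        smooth_cyl rho,
        forall c : R, 0 < c -> compact (rho @^-1` `[0, c]) &
        forall p, (conorm w p (fun u => dir u rho p) <= 1)%E].

Definition complete_kahler (w : form2) : Prop := kahler w /\ complete_metric w.

End Cylinder.

Definition constC (R : realType) : R :=
  4 * (1 + expR (Num.sqrt 3)) ^+ 2 * expR (Num.sqrt 3).

Definition psi (R : realType) (n : nat) (x : 'rV[R]_n) : R :=
  \sum_(j < n) (ln (1 / (1 + x 0 j ^+ 2)) + constC R * ln (1 + expR (x 0 j))).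

(* Main.v *)
Require Import Defs.
From HB Require Import structures.
From mathcomp Require Import all_boot all_order all_algebra.
From mathcomp Require Import complex.
From mathcomp Require Import all_classical all_reals all_analysis.
From mathcomp Require Import ring lra.

Import Order.TTheory GRing.Theory Num.Theory.
Import numFieldNormedType.Exports.

Local Open Scope classical_set_scope.
Local Open Scope ring_scope.

Set Implicit Arguments.
Unset Strict Implicit.
Unset Printing Implicit Defensive.

(** The function psi is a sum of one-variable functions phi(x_j), where
   phi(t) = C ln (1 + e^t) - ln (1 + t^2), so everything reduces to phi' and
   phi''.

   - Gradient: phi'(t) = C e^t / (1 + e^t) - 2t / (1 + t^2), where the first
     term lies in ]0, C[ and the subtracted one in [-1, 1] ([dphi_bounds]).
   - Convexity: phi''(t) = C e^t / (1 + e^t)^2 + 2(t^2 - 1) / (1 + t^2)^2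
     satisfies phi''(t) >= 1 / (1 + t^2) ([ddphi_ge]). For t^2 >= 3 the second
     term alone suffices; for t^2 <= 3 the constant C makes the first term at
     least 4, while the second is at least -2. The Hessian of psi is diagonal
     with entries phi''(x_j), hence positive definite.
   - Kahler form: on the cylinder, dd^c psi = sum_j phi''(x_j) dx_j /\ dy_j
     ([ddc_psi]). It is closed since the coefficient of dx_j /\ dy_j depends
     on x_j only, and its metric is
     sum_j phi''(x_j) (dx_j^2 + dy_j^2) ([metric_ddc_psi]).
   - Completeness: the function rho = (2(n + 1))^-1 sum_j ln (1 + x_j^2) is
     proper because the torus directions are compact. By the lower bound
     on phi'', the form 2x_j / (1 + x_j^2) dx_j has norm at most 2, so
     |d rho| <= n / (n + 1) <= 1 ([conorm_exhaustion]).

   Smoothness comes from closure of the smooth functions on a normed module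
   under sums, products, inverses, exp and ln. All derivatives of functions
   sum_j c_j g(x_j), on R^n and on the cylinder alike, come from the single
   chain rule [derive_sum_comp]. *)

(** * Smooth functions on a normed module *)

Section Smoothness.
Context {R : realType} {V : normedModType R}.
Implicit Types (f g : V -> R) (p v : V) (k : nat).

Lemma derive_comp (g : R -> R) (g' : R) (f : V -> R) (p v : V) :
  differentiable f p -> is_derive (f p) 1 g g' ->
  'D_v (fun q => g (f q)) p = g' * 'D_v f p.
Proof.
move=> df dg; have dg' : differentiable g (f p).
  by apply/derivable1_diffP; exact: ex_derive.
rewrite (deriveE v (differentiable_comp df dg')) diff_comp//= (deriveE v df).
by rewrite diff1E//= derive1E derive_val mulrC.
Qed.

Lemma differentiable_comp_derive (g : R -> R) (g' : R) (f : V -> R) (p : V) :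
  differentiable f p -> is_derive (f p) 1 g g' ->
  differentiable (fun q => g (f q)) p.
Proof.
move=> df dg; apply: (@differentiable_comp _ _ _ _ f g) => //.
by apply/derivable1_diffP; exact: ex_derive.
Qed.

Lemma is_derive_fD f g p v (f' g' : R) :
  is_derive p v f f' -> is_derive p v g g' ->
  is_derive p v (fun q => f q + g q) (f' + g').
Proof. exact: (@is_deriveD R V R f g). Qed.

Lemma is_derive_fM f g p v (f' g' : R) :
  is_derive p v f f' -> is_derive p v g g' ->
  is_derive p v (fun q => f q * g q) (f p * g' + g p * f').
Proof. exact: (@is_deriveM R V f g). Qed.

Lemma is_derive_cM (c : R) f p v (f' : R) :
  is_derive p v f f' -> is_derive p v (fun q => c * f q) (c * f').
Proof. exact: (@is_deriveZ R V R f). Qed.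

Lemma eq_Ck k f g : f =1 g -> Ck k g -> Ck k f.
Proof. by move=> /funext ->. Qed.

Lemma Ck_continuous k f : Ck k f -> continuous f.
Proof.
case: k => [//|k] [df _] p; exact: differentiable_continuous.
Qed.

Lemma CkW k f : Ck k.+1 f -> Ck k f.
Proof.
elim: k f => [|k IH] f [df Df]; first exact: (@Ck_continuous 1).
by split=> // v; apply: IH; exact: Df.
Qed.

Lemma Ck_cst k (c : R) : Ck k (fun _ : V => c).
Proof.
elim: k c => [|k IH] c; first by move=> p; exact: cvg_cst.
split=> [p|v]; first exact: differentiable_cst.
by apply: eq_Ck (IH 0) => p; exact: derive_cst.
Qed.

Lemma CkD k f g : Ck k f -> Ck k g -> Ck k (fun p => f p + g p).
Proof.
elim: k f g => [|k IH] f g; first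
  by move=> cf cg p; apply: cvgD; [exact: cf|exact: cg].
move=> [df Df] [dg Dg].
split=> [p|v]; first exact: (@differentiableD _ _ _ f g).
apply: eq_Ck (IH _ _ (Df v) (Dg v)) => p.
by apply: (@deriveD _ _ _ f g); exact: diff_derivable.
Qed.

Lemma CkM k f g : Ck k f -> Ck k g -> Ck k (fun p => f p * g p).
Proof.
elim: k f g => [|k IH] f g; first
  by move=> cf cg p; apply: cvgM; [exact: cf|exact: cg].
move=> fk gk; have [df Df] := fk; have [dg Dg] := gk.
split=> [p|v]; first exact: (@differentiableM _ _ f g).
apply: (@eq_Ck _ _ (fun p => f p * 'D_v g p + g p * 'D_v f p)) => [p|].
  by apply: (@deriveM _ _ f g); exact: diff_derivable.
by apply: CkD; apply: IH; [exact: CkW|exact: Dg|exact: CkW|exact: Df].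
Qed.

Lemma Ck_sum k (I : Type) (s : seq I) (F : I -> V -> R) :
  (forall i, Ck k (F i)) -> Ck k (fun p => \sum_(i <- s) F i p).
Proof.
move=> Fk; elim: s => [|i s IH].
  by apply: eq_Ck (Ck_cst k 0) => p; rewrite big_nil.
by apply: eq_Ck (CkD (Fk i) IH) => p; rewrite big_cons.
Qed.

Lemma CkV k f : (forall p, f p != 0) -> Ck k f -> Ck k (fun p => (f p)^-1).
Proof.
move=> f0; elim: k => [|k IH]; first
  by move=> cf p; apply: cvgV; [exact: f0|exact: cf].
move=> fk; have [df Df] := fk.
split=> [p|v]; first exact: differentiableV.
apply: (@eq_Ck _ _ (fun p => (-1) * ((f p)^-1 * (f p)^-1) * 'D_v f p)) => [p|].
  rewrite deriveV//; last exact: diff_derivable.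
  by rewrite /GRing.scale/= -exprVn expr2 mulN1r.
apply: CkM; last exact: Df.
by apply: CkM; [exact: Ck_cst|apply: CkM; apply: IH; exact: CkW].
Qed.

Lemma Ck_expR k f : Ck k f -> Ck k (fun p => expR (f p)).
Proof.
elim: k => [|k IH].
  by move=> cf p; apply: continuous_comp; [exact: cf|exact: continuous_expR].
move=> fk; have [df Df] := fk.
split=> [p|v]; first exact: differentiable_comp_derive.
apply: (@eq_Ck _ _ (fun p => expR (f p) * 'D_v f p)) => [p|].
  exact: derive_comp.
by apply: CkM; [apply: IH; exact: CkW|exact: Df].
Qed.

Lemma smooth_cst (c : R) : smooth (fun _ : V => c).
Proof. move=> k; exact: Ck_cst. Qed.

Lemma smoothD f g : smooth f -> smooth g -> smooth (fun p => f p + g p).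
Proof. by move=> sf sg k; apply: CkD. Qed.

Lemma smoothM f g : smooth f -> smooth g -> smooth (fun p => f p * g p).
Proof. by move=> sf sg k; apply: CkM. Qed.

Lemma smooth_sum (I : Type) (s : seq I) (F : I -> V -> R) :
  (forall i, smooth (F i)) -> smooth (fun p => \sum_(i <- s) F i p).
Proof. by move=> sF k; apply: Ck_sum => i; exact: sF. Qed.

Lemma smoothV f :
  (forall p, f p != 0) -> smooth f -> smooth (fun p => (f p)^-1).
Proof. by move=> f0 sf k; exact: CkV. Qed.

Lemma smooth_expR f : smooth f -> smooth (fun p => expR (f p)).
Proof. by move=> sf k; exact: Ck_expR. Qed.

Lemma smooth_differentiable f p : smooth f -> differentiable f p.
Proof. by move=> /(_ 1%N) [df _]. Qed.

Lemma smooth_ln f :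
  (forall p, 0 < f p) -> smooth f -> smooth (fun p => ln (f p)).
Proof.
move=> f0 sf; have dln p : differentiable (fun q => ln (f q)) p.
  apply: differentiable_comp_derive; first exact: smooth_differentiable.
  exact: is_derive1_ln.
case=> [|k]; first by move=> p; apply: differentiable_continuous.
split=> // v.
(* No induction is needed: the derivative of ln f no longer involves ln. *)
apply: (@eq_Ck _ _ (fun p => (f p)^-1 * 'D_v f p)) => [p|].
  apply: derive_comp; first exact: smooth_differentiable.
  exact: is_derive1_ln.
apply: CkM; last by case: (sf k.+1) => _; exact.
by apply: CkV => // p; rewrite gt_eqF.
Qed.

Lemma derive_linear (l : {linear V -> R}) p v :
  continuous l -> 'D_v l p = l v.
Proof.
by move=> cl; rewrite deriveE ?diff_lin//; exact: linear_differentiable.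
Qed.

Lemma smooth_linear (l : {linear V -> R}) : continuous l -> smooth l.
Proof.
move=> cl [//|k]; split=> [p|v]; first exact: linear_differentiable.
by apply: eq_Ck (Ck_cst k (l v)) => p; exact: derive_linear.
Qed.

Lemma is_derive_sum_comp (I : Type) (s : seq I) (l : I -> {linear V -> R})
    (c : I -> R) (g g' : R -> R) (p v : V) :
  (forall i, continuous (l i)) -> (forall t : R, is_derive t 1 g (g' t)) ->
  is_derive p v (fun q => \sum_(i <- s) c i * g (l i q))
    (\sum_(i <- s) c i * l i v * g' (l i p)).
Proof.
move=> cl dg.
have H i : is_derive p v (fun q => c i * g (l i q)) (c i * l i v * g' (l i p)).
  have dl : differentiable (l i) p by exact: linear_differentiable.
  rewrite -mulrA [l i v * _]mulrC -(derive_linear p v)//.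
  rewrite -(derive_comp v dl (dg _)); apply: is_derive_cM; apply: derivableP.
  by apply: diff_derivable; exact: differentiable_comp_derive.
elim: s => [|i s IH].
  rewrite big_nil (_ : (fun p => _) = cst 0); first exact: is_derive_cst.
  by apply/funext => q; rewrite big_nil.
rewrite big_cons (_ : (fun p => _) =
  (fun q => c i * g (l i q) + \sum_(j <- s) c j * g (l j q))).
  exact: is_derive_fD.
by apply/funext => q; rewrite big_cons.
Qed.

(** The derivative along v of q |-> sum_i c_i g(l_i q), for linear forms l_i.
   The result has the same shape with c_i replaced by c_i l_i(v), so that the
   lemma can be iterated. *)
Lemma derive_sum_comp (I : Type) (s : seq I) (l : I -> {linear V -> R})
    (c : I -> R) (g g' : R -> R) (p v : V) :
  (forall i, continuous (l i)) -> (forall t : R, is_derive t 1 g (g' t)) ->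
  'D_v (fun q => \sum_(i <- s) c i * g (l i q)) p
    = \sum_(i <- s) c i * l i v * g' (l i p).
Proof. by move=> cl dg; have [] := is_derive_sum_comp s c p v cl dg. Qed.

End Smoothness.

(** * The one-variable function phi *)

Section OneVariable.
Context {R : realType}.
Implicit Types (t : R).
Local Notation C := (constC R).

(** The summand of psi, followed by its first and second derivatives. *)
Definition phi t : R := ln (1 / (1 + t ^+ 2)) + C * ln (1 + expR t).
Definition dphi t : R := C * (expR t / (1 + expR t)) - 2 * t / (1 + t ^+ 2).
Definition ddphi t : R :=
  C * (expR t / (1 + expR t) ^+ 2) + 2 * (t ^+ 2 - 1) / (1 + t ^+ 2) ^+ 2.

Lemma add1sqr_gt0 t : 0 < 1 + t ^+ 2.
Proof. by rewrite ltr_pwDl// sqr_ge0. Qed.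

Lemma add1expR_gt0 t : 0 < 1 + expR t.
Proof. by rewrite addr_gt0// expR_gt0. Qed.

Lemma constC_gt0 : 0 < C.
Proof. by rewrite !mulr_gt0 ?exprn_gt0 ?add1expR_gt0 ?expR_gt0. Qed.

Lemma is_derive_add1sqr t : is_derive t 1 (fun x : R => 1 + x ^+ 2) (2 * t).
Proof.
rewrite (_ : 2 * t = 0 + (t * 1 + t * 1)); last by ring.
by apply: is_derive_fD; apply: is_derive_fM.
Qed.

Lemma is_derive_add1expR t : is_derive t 1 (fun x : R => 1 + expR x) (expR t).
Proof.
rewrite -[X in is_derive _ _ _ X]add0r.
exact: is_derive_fD.
Qed.

Lemma is_derive_ln1sqr t :
  is_derive t 1 (fun x : R => ln (1 + x ^+ 2)) (2 * t / (1 + t ^+ 2)).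
Proof.
rewrite mulrC; apply: (@is_derive1_comp _ (@ln R) (fun x => 1 + x ^+ 2)).
  by apply: is_derive1_ln; exact: add1sqr_gt0.
exact: is_derive_add1sqr.
Qed.

Lemma is_derive_ln1expR t :
  is_derive t 1 (fun x : R => ln (1 + expR x)) (expR t / (1 + expR t)).
Proof.
rewrite mulrC; apply: (@is_derive1_comp _ (@ln R) (fun x => 1 + expR x)).
  by apply: is_derive1_ln; exact: add1expR_gt0.
exact: is_derive_add1expR.
Qed.

Lemma phiE : phi = fun t => C * ln (1 + expR t) - ln (1 + t ^+ 2).
Proof.
apply/funext => t; rewrite /phi addrC div1r lnV//.
by rewrite posrE add1sqr_gt0.
Qed.

Lemma is_derive_phi t : is_derive t 1 phi (dphi t).
Proof.
have He := is_derive_cM C (is_derive_ln1expR t).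
have Hs := is_derive_cM (-1) (is_derive_ln1sqr t).
rewrite phiE (_ : (fun x => _) =
    fun x => C * ln (1 + expR x) + -1 * ln (1 + x ^+ 2)).
  by apply: is_derive_eq (is_derive_fD He Hs) _; rewrite mulN1r.
by apply/funext => x; rewrite mulN1r.
Qed.

Lemma is_derive_dphi t : is_derive t 1 dphi (ddphi t).
Proof.
have e0 (x : R) : 1 + expR x != 0 by rewrite gt_eqF ?add1expR_gt0.
have s0 (x : R) : 1 + x ^+ 2 != 0 by rewrite gt_eqF ?add1sqr_gt0.
have He : is_derive t 1 (fun x : R => (1 + expR x)^-1)
    (- (1 + expR t) ^- 2 * expR t).
  by apply: is_deriveV; [exact: e0|exact: is_derive_add1expR].
have Hs : is_derive t 1 (fun x : R => (1 + x ^+ 2)^-1)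
    (- (1 + t ^+ 2) ^- 2 * (2 * t)).
  by apply: is_deriveV; [exact: s0|exact: is_derive_add1sqr].
have Hid := is_derive_id t (1 : R).
have Hq := is_derive_cM C (is_derive_fM (is_derive_expR t) He).
have Hp := is_derive_fM (is_derive_cM (-2) Hid) Hs.
rewrite (_ : dphi = fun x =>
    C * (expR x * (1 + expR x)^-1) + -2 * x * (1 + x ^+ 2)^-1).
  apply: is_derive_eq (is_derive_fD Hq Hp) _.
  by rewrite /ddphi; field; rewrite e0 s0.
by apply/funext => x; rewrite /dphi -2!mulNr.
Qed.

Lemma smooth_add1sqr {V : normedModType R} (f : V -> R) :
  smooth f -> smooth (fun p => 1 + f p ^+ 2).
Proof. by move=> sf; apply: smoothD; [exact: smooth_cst|exact: smoothM]. Qed.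

Lemma smooth_add1expR {V : normedModType R} (f : V -> R) :
  smooth f -> smooth (fun p => 1 + expR (f p)).
Proof.
by move=> sf; apply: smoothD; [exact: smooth_cst|exact: smooth_expR].
Qed.

Lemma smooth_phi {V : normedModType R} (f : V -> R) :
  smooth f -> smooth (fun p => phi (f p)).
Proof.
move=> sf; rewrite phiE.
apply: smoothD.
  apply: smoothM; first exact: smooth_cst.
  by apply: smooth_ln; [move=> p; exact: add1expR_gt0|exact: smooth_add1expR].
rewrite (_ : (fun p => - _) = fun p => -1 * ln (1 + f p ^+ 2)).
  apply: smoothM; first exact: smooth_cst.
  by apply: smooth_ln; [move=> p; exact: add1sqr_gt0|exact: smooth_add1sqr].
by apply/funext => p; rewrite mulN1r.
Qed.

Lemma smooth_ddphi {V : normedModType R} (f : V -> R) :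
  smooth f -> smooth (fun p => ddphi (f p)).
Proof.
move=> sf.
have se : smooth (fun p => ((1 + expR (f p)) ^+ 2)^-1).
  apply: smoothV => [p|]; first by rewrite gt_eqF ?exprn_gt0 ?add1expR_gt0.
  by apply: smoothM; exact: smooth_add1expR.
have ss : smooth (fun p => ((1 + f p ^+ 2) ^+ 2)^-1).
  apply: smoothV => [p|]; first by rewrite gt_eqF ?exprn_gt0 ?add1sqr_gt0.
  by apply: smoothM; exact: smooth_add1sqr.
apply: smoothD; apply: smoothM => //; first exact: smooth_cst.
- by apply: smoothM => //; exact: smooth_expR.
- apply: smoothM; first exact: smooth_cst.
  by apply: smoothD; [exact: smoothM|exact: smooth_cst].
Qed.

(** Only the existence of phi''' matters, not its value. *)
Lemma is_derive_ddphi t : is_derive t 1 ddphi ('D_1 ddphi t).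
Proof.
apply: derivableP; apply: diff_derivable.
have sid : smooth (id : R -> R).
  by apply: (@smooth_linear R R idfun) => x; exact: cvg_id.
exact: (smooth_differentiable t (smooth_ddphi sid)).
Qed.

Lemma dphi_bounds t : -1 < dphi t < C + 1.
Proof.
have e0 := expR_gt0 t; have e1 := add1expR_gt0 t; have s0 := add1sqr_gt0 t.
have C0 := constC_gt0.
have /andP[r0 r1] : 0 < expR t / (1 + expR t) < 1.
  by rewrite divr_gt0//= ltr_pdivrMr// mul1r ltrDr.
(* Both bounds amount to (t + 1)^2 >= 0 and (t - 1)^2 >= 0. *)
have /andP[q0 q1] : -1 <= 2 * t / (1 + t ^+ 2) <= 1.
  rewrite ler_pdivlMr// ler_pdivrMr// mulN1r mul1r.
  have := sqr_ge0 (t - 1); have := sqr_ge0 (t + 1).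
  by rewrite sqrrD1 sqrrB1 => h1 h2; apply/andP; split; lra.
have : 0 < C * (expR t / (1 + expR t)) by rewrite mulr_gt0.
have : C * (expR t / (1 + expR t)) < C by rewrite gtr_pMr.
by rewrite /dphi => h1 h2; apply/andP; split; lra.
Qed.

(** The estimate behind both the convexity of psi and the completeness of its
   metric. *)
Lemma ddphi_ge t : (1 + t ^+ 2)^-1 <= ddphi t.
Proof.
have s0 := add1sqr_gt0 t; have C0 := constC_gt0.
have sq0 : 0 < (1 + t ^+ 2) ^+ 2 by rewrite exprn_gt0.
have e20 (x : R) : 0 < (1 + expR x) ^+ 2 by rewrite exprn_gt0// add1expR_gt0.
rewrite /ddphi; case: (lerP 3 (t ^+ 2)) => t3.
  apply: (@le_trans _ _ (2 * (t ^+ 2 - 1) / (1 + t ^+ 2) ^+ 2)).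
    rewrite ler_pdivlMr// expr2 mulKf ?gt_eqF//; lra.
  by rewrite lerDr mulr_ge0 ?divr_ge0 ?expR_ge0// ltW.
have t2 : `|t| <= Num.sqrt 3 by rewrite -sqrtr_sqr ler_wsqrtr// ltW.
have /andP[tl tr] : - Num.sqrt 3 <= t <= Num.sqrt 3 by rewrite -ler_norml.
(* C = 4 (1 + e^sqrt 3)^2 e^sqrt 3 is chosen so that this holds whenever
   |t| <= sqrt 3. *)
have C4 : 4 <= C * (expR t / (1 + expR t) ^+ 2).
  rewrite mulrA ler_pdivlMr// /constC -2!mulrA ler_pM2l//.
  apply: (@le_trans _ _ ((1 + expR (Num.sqrt 3)) ^+ 2)).
    rewrite ler_pXn2r ?nnegrE ?(ltW (add1expR_gt0 _))//.
    by rewrite lerD2l ler_expR.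
  by rewrite ler_peMr ?sqr_ge0// -expRD -[leLHS]expR0 ler_expR; lra.
have : -2 <= 2 * (t ^+ 2 - 1) / (1 + t ^+ 2) ^+ 2.
  rewrite ler_pdivlMr//; have := sqr_ge0 t; nra.
have : (1 + t ^+ 2)^-1 <= 1 by rewrite invf_le1// lerDl sqr_ge0.
lra.
Qed.

Lemma ddphi_gt0 t : 0 < ddphi t.
Proof. by apply: lt_le_trans (ddphi_ge t); rewrite invr_gt0 add1sqr_gt0. Qed.

(** The derivative of ln (1 + t^2), squared, is controlled by phi''. *)
Lemma sqr_dln1sqr_le t : (2 * t / (1 + t ^+ 2)) ^+ 2 <= 4 * ddphi t.
Proof.
apply: (@le_trans _ _ (4 * (1 + t ^+ 2)^-1)); last first.
  by rewrite ler_pM2l// ddphi_ge.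
have s0 := add1sqr_gt0 t.
rewrite expr_div_n ler_pdivrMr ?exprn_gt0//.
rewrite [leRHS](_ : _ = 4 * (1 + t ^+ 2)); last by field; rewrite gt_eqF.
by rewrite exprMn; lra.
Qed.

End OneVariable.

(** * Coordinates as linear forms *)

Section Coordinates.
Context {R : realType} {n : nat}.
Implicit Types (j : 'I_n).

(** The j-th coordinate on R^n. *)
Definition coord_rV j (x : 'rV[R]_n) : R := x 0 j.

Fact coord_rV_is_linear j : linear (coord_rV j).
Proof. by move=> a x y; rewrite /coord_rV !mxE. Qed.
HB.instance Definition _ j :=
  GRing.isLinear.Build R 'rV[R]_n R _ (coord_rV j) (coord_rV_is_linear j).

Lemma coord_rV_continuous j : continuous (coord_rV j).
Proof. exact: coord_continuous. Qed.

(** The real part of the j-th coordinate on C^n. *)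
Definition coord_re j (p : Cn R n) : R := p.1 0 j.

Fact coord_re_is_linear j : linear (coord_re j).
Proof. by move=> a x y; rewrite /coord_re !mxE. Qed.
HB.instance Definition _ j :=
  GRing.isLinear.Build R (Cn R n) R _ (coord_re j) (coord_re_is_linear j).

Lemma coord_re_continuous j : continuous (coord_re j).
Proof.
move=> p; apply: (@continuous_comp _ _ _ fst (coord_rV j)).
  exact: cvg_fst.
exact: coord_rV_continuous.
Qed.

End Coordinates.

(** * Gradient and Hessian of psi *)

Section Convexity.
Context {R : realType} {n : nat}.
Implicit Types (x u v : 'rV[R]_n).

(** The factors 1 put psi in the form required by [derive_sum_comp]. *)
Lemma psiE : @psi R n = fun x => \sum_(j < n) 1 * phi (coord_rV j x).
Proof.
by apply/funext => x; rewrite /psi; under [RHS]eq_bigr do rewrite mul1r.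
Qed.

Lemma derive_psi u x : 'D_u (@psi R n) x = \sum_(j < n) u 0 j * dphi (x 0 j).
Proof.
rewrite psiE (derive_sum_comp _ _ _ _ coord_rV_continuous is_derive_phi).
by apply: eq_bigr => j _; rewrite mul1r.
Qed.

Lemma derive2_psi u v x :
  'D_v ('D_u (@psi R n)) x = \sum_(j < n) u 0 j * v 0 j * ddphi (x 0 j).
Proof.
rewrite (funext (derive_psi u)).
exact: (derive_sum_comp _ (fun j => u 0 j) x v coord_rV_continuous
  is_derive_dphi).
Qed.

Lemma smooth_psi : smooth (@psi R n).
Proof.
rewrite psiE; apply: smooth_sum => j; apply: smoothM; first exact: smooth_cst.
by apply: smooth_phi; apply: smooth_linear; exact: coord_rV_continuous.
Qed.

Lemma basisE (i j : 'I_n) : Defs.basis R i 0 j = (j == i)%:R.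
Proof. by rewrite mxE eqxx. Qed.

Lemma gradient_psi x : gradient (@psi R n) x = \row_j dphi (x 0 j).
Proof.
apply/rowP => j; rewrite !mxE derive_psi (bigD1 j)//= basisE eqxx mul1r.
by rewrite big1 ?addr0// => i /negPf ij; rewrite basisE ij mul0r.
Qed.

Lemma hessian_psi x : hessian (@psi R n) x = diag_mx (\row_j ddphi (x 0 j)).
Proof.
apply/matrixP => i j; rewrite !mxE derive2_psi (bigD1 j)//= !basisE eqxx mul1r.
rewrite big1 ?addr0 => [|k /negPf kj]; last by rewrite basisE kj !mul0r.
by rewrite mulr_natl eq_sym; case: eqP => [->|].
Qed.

Lemma posdefmx_diag (d : 'rV[R]_n) :
  (forall j, 0 < d 0 j) -> posdefmx (diag_mx d).
Proof.
move=> d0; split=> [|v]; first exact: tr_diag_mx.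
move=> /rV0Pn[j vj]; rewrite mul_mx_diag mxE (bigD1 j)//= !mxE.
rewrite mulrAC ltr_pwDl//.
  by rewrite mulr_gt0// -expr2 lt_neqAle sqr_ge0 eq_sym sqrf_eq0 vj.
apply: sumr_ge0 => i _.
by rewrite !mxE mulrAC mulr_ge0 ?(ltW (d0 i))// -expr2 sqr_ge0.
Qed.

Lemma strictly_convex_psi : strictly_convex (@psi R n).
Proof.
split=> [|x]; first exact: smooth_psi.
by rewrite hessian_psi; apply: posdefmx_diag => j; rewrite mxE ddphi_gt0.
Qed.

End Convexity.

(** * The form dd^c psi on the cylinder *)

Section CylinderCalculus.
Context {R : realType} {n : nat}.
Implicit Types (p q : cylinder R n) (u v t : Cn R n) (j : 'I_n).

Section Separable.
Variables (c : 'I_n -> R) (g g' : R -> R).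

(** The function sum_j c_j g(x_j) on the cylinder. The values of d^c psi
   and dd^c psi on constant vector fields, and the exhaustion function, all
   have this form. *)
Definition coord_sum p : R := \sum_(j < n) c j * g (real_part p 0 j).

Lemma coord_sum_proj :
  coord_sum \o @Defs.proj R n =
    fun z : Cn R n => \sum_(j < n) c j * g (coord_re j z).
Proof.
by apply/funext => z; apply: eq_bigr => j _; rewrite real_part_proj.
Qed.

Lemma smooth_coord_sum :
  (forall f : Cn R n -> R, smooth f -> smooth (fun z => g (f z))) ->
  smooth_cyl coord_sum.
Proof.
move=> sg; rewrite /smooth_cyl coord_sum_proj.
apply: smooth_sum => j; apply: smoothM; first exact: smooth_cst.
by apply: sg; apply: smooth_linear; exact: coord_re_continuous.
Qed.

Lemma dir_coord_sum (dg : forall s : R, is_derive s 1 g (g' s)) u p :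
  dir u coord_sum p = \sum_(j < n) c j * u.1 0 j * g' (real_part p 0 j).
Proof.
rewrite /dir coord_sum_proj.
exact: (derive_sum_comp _ c (repr p) u coord_re_continuous dg).
Qed.

End Separable.

Lemma dir_cst u (a : R) p : dir u (fun _ => a) p = 0.
Proof. exact: derive_cst. Qed.

Local Notation F := (fun p : cylinder R n => psi (real_part p)).

Lemma psi_coord_sum : F = coord_sum (fun _ => 1) phi.
Proof. by apply/funext => p; under [RHS]eq_bigr do rewrite mul1r. Qed.

Lemma dir_psi u p : dir u F p = \sum_(j < n) u.1 0 j * dphi (real_part p 0 j).
Proof.
rewrite psi_coord_sum (dir_coord_sum _ is_derive_phi).
by apply: eq_bigr => j _; rewrite mul1r.
Qed.

Lemma dirC_real u (f : cylinder R n -> R) p :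
  dirC u (fun q => (f q)%:C%C) p = (dir u f p)%:C%C.
Proof. by rewrite /dirC /= dir_cst. Qed.

Lemma d_dx_psi j p :
  d_dx j (fun q => (F q)%:C%C) p = (dphi (real_part p 0 j))%:C%C.
Proof.
rewrite /d_dx dirC_real dir_psi (bigD1 j)//= basisE eqxx mul1r.
by rewrite big1 ?addr0// => i /negPf ij; rewrite basisE ij mul0r.
Qed.

Lemma d_dy_psi j p : d_dy j (fun q => (F q)%:C%C) p = 0.
Proof.
rewrite /d_dy dirC_real dir_psi big1// => i _.
by rewrite mxE mul0r.
Qed.

(** d^c psi = sum_j phi'(x_j) dy_j. *)
Lemma dc_psi : dc (fun q => (F q)%:C%C) = fun p u =>
  (coord_sum (fun j => u.2 0 j) dphi p)%:C%C.
Proof.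
apply/funext => p; apply/funext => u.
rewrite /dc /partialbar /partial !mulr_sumr -sumrB /coord_sum rmorph_sum/=.
apply: eq_bigr => j _.
rewrite /d_dz /d_dzbar d_dx_psi d_dy_psi mulr0 addr0 subr0.
set a := dphi _.
have -> : dz j u = (u.1 0 j)%:C%C + 'i%C * (u.2 0 j)%:C%C by exact: complexE.
have -> : dzbar j u = (u.1 0 j)%:C%C - 'i%C * (u.2 0 j)%:C%C.
  by rewrite /dzbar; simpc.
rewrite rmorphM/=.
(* The contribution of u is i/2 a (dzbar - dz)(u) = - i^2 a dy(u). *)
transitivity (- 'i%C ^+ 2 * ((u.2 0 j)%:C%C * a%:C%C) : R[i]); first by field.
by rewrite sqr_i opprK mul1r.
Qed.

(** dd^c psi = sum_j phi''(x_j) dx_j /\ dy_j. *)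
Lemma ddc_psi : ddc F = fun p u v => (coord_sum
  (fun j => u.1 0 j * v.2 0 j - v.1 0 j * u.2 0 j) ddphi p)%:C%C.
Proof.
apply/funext => p; apply/funext => u; apply/funext => v.
rewrite /ddc /ext_d1 dc_psi !dirC_real !(dir_coord_sum _ is_derive_dphi).
rewrite -rmorphB -sumrB; congr (_%:C%C).
by apply: eq_bigr => j _; rewrite -mulrBl [v.2 _ _ * _]mulrC [u.2 _ _ * _]mulrC.
Qed.

Lemma metric_ddc_psi p u : metric (ddc F) p u u =
  \sum_(j < n) (u.1 0 j ^+ 2 + u.2 0 j ^+ 2) * ddphi (real_part p 0 j).
Proof.
rewrite /metric ddc_psi/=; apply: eq_bigr => j _.
by rewrite mxE mulNr opprK !expr2.
Qed.

Lemma hermitian_ddc_psi : hermitian_form (ddc F).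
Proof.
split; rewrite ?ddc_psi.
- move=> u v; split; first by apply: smooth_coord_sum => f; exact: smooth_ddphi.
  exact: smooth_cst.
- move=> p; split=> [a u u' v|u v].
    rewrite -rmorphM -rmorphD; congr (_%:C%C).
    rewrite /coord_sum mulr_sumr -big_split/=; apply: eq_bigr => j _.
    by rewrite !mxE; ring.
  rewrite -rmorphN -sumrN; congr (_%:C%C); apply: eq_bigr => j _.
  by ring.
- by [].
- move=> p u v; congr (_%:C%C); apply: eq_bigr => j _.
  by rewrite !mxE; ring.
  (* Positivity: a nonzero vector has a nonzero coordinate. *)
- move=> p u u0; rewrite -ddc_psi metric_ddc_psi.
  have [j uj] : exists j, 0 < u.1 0 j ^+ 2 + u.2 0 j ^+ 2.
    move: u0; apply: contraPP => /forallNP H.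
    suff -> : u = 0 by rewrite eqxx.
    have H0 j : u.1 0 j = 0 /\ u.2 0 j = 0.
      have := H j; have := sqr_ge0 (u.1 0 j); have := sqr_ge0 (u.2 0 j).
      move=> h1 h2 /negP; rewrite -leNgt => h3.
      by split; apply/eqP; rewrite -sqrf_eq0 eq_le; apply/andP; split; lra.
    rewrite [u]surjective_pairing; congr (_, _); apply/rowP => j; rewrite mxE;
      by have [] := H0 j.
  rewrite (bigD1 j)//= ltr_pwDl// ?mulr_gt0 ?ddphi_gt0//.
  apply: sumr_ge0 => i _; apply: mulr_ge0; last exact/ltW/ddphi_gt0.
  by rewrite addr_ge0 ?sqr_ge0.
Qed.

(** The exterior derivative of dd^c psi vanishes summand by summand: it involves
   dx_j /\ dx_j /\ dy_j only. *)
Lemma kahler_ddc_psi : kahler (ddc F).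
Proof.
split=> [|p u v t]; first exact: hermitian_ddc_psi.
rewrite /ext_d2 ddc_psi !dirC_real !(dir_coord_sum _ is_derive_ddphi).
rewrite -rmorphB -rmorphD -sumrB -big_split/= big1// => j _.
by ring.
Qed.

(** * Completeness *)

(** The exhaustion function witnessing completeness; its normalization makes it
   1-Lipschitz for the metric of dd^c psi, in every dimension n (n = 0
   included). *)
Definition exhaustion : cylinder R n -> R :=
  coord_sum (fun _ => (2 * n.+1%:R)^-1) (fun s => ln (1 + s ^+ 2)).

Lemma ln1sqr_ge0 (s : R) : 0 <= ln (1 + s ^+ 2).
Proof. by rewrite ln_ge0// lerDl sqr_ge0. Qed.

Lemma exhaustion_ge0 p : 0 <= exhaustion p.
Proof.
by apply: sumr_ge0 => j _; rewrite mulr_ge0 ?ln1sqr_ge0// invr_ge0 mulr_ge0.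
Qed.

Lemma smooth_exhaustion : smooth_cyl exhaustion.
Proof.
apply: smooth_coord_sum => f sf; apply: smooth_ln => [z|].
  exact: add1sqr_gt0.
exact: smooth_add1sqr.
Qed.

(** The cylinder is covered by R^n x [0, 1]^n. *)
Lemma proj_surj p :
  exists2 z : Cn R n, Defs.proj z = p & forall j, 0 <= z.2 0 j <= 1.
Proof.
pose k : 'rV[int]_n := \row_j - Num.floor ((repr p).2 0 j).
exists ((repr p).1, (repr p).2 + map_mx intr k) => [|j /=].
  rewrite -[RHS]reprK; apply/esym/eqmodP/asboolP; exists k.
  by rewrite /GRing.add/=; congr (_, _); rewrite ?subrr// addrAC subrr add0r.
pose y : R := (repr p).2 0 j.
have h1 := floor_le y; have h2 := floorD1_gt y.
rewrite intrD mulr1z in h2; rewrite !mxE rmorphN/= -/y.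
by apply/andP; split; lra.
Qed.

(** A sublevel set is closed and contained in the image of the compact box
   [-M, M]^n x [0, 1]^n. *)
Lemma compact_exhaustion (c : R) : compact (exhaustion @^-1` `[0, c]).
Proof.
pose M : R := Num.sqrt (expR (2 * n.+1%:R * c)).
pose A : set 'rV[R]_n := [set x | forall j, `[- M, M]%classic (x 0 j)].
pose B : set 'rV[R]_n := [set y | forall j, `[0, 1]%classic (y 0 j)].
apply: (@subclosed_compact _ _ (@Defs.proj R n @` (A `*` B))).
  (* Continuity of the exhaustion function is the order 0 case of its
     smoothness. *)
- apply: preimage_closed; last exact: itv_closed.
  move=> p _; move: p; apply/quotient_continuous.
  exact: (smooth_exhaustion 0%N).
- apply: continuous_compact.
    by apply: continuous_subspaceT; exact: pi_continuous.
  apply: compact_setX; apply: (@rV_compact R n (fun=> _)) => j;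
    exact: segment_compact.
- move=> p /=; rewrite in_itv/= => /andP[_ pc].
  have [z zp z2] := proj_surj p; exists z => //.
  split=> j /=; rewrite in_itv/=//.
  have : (2 * n.+1%:R)^-1 * ln (1 + z.1 0 j ^+ 2) <= c.
    apply: le_trans pc; rewrite -zp /exhaustion /coord_sum real_part_proj.
    rewrite (bigD1 j)//= lerDl; apply: sumr_ge0 => i _.
    by rewrite mulr_ge0 ?ln1sqr_ge0// invr_ge0 mulr_ge0.
  rewrite ler_pdivrMl ?mulr_gt0// -ler_expR lnK ?posrE ?add1sqr_gt0// => hz.
  rewrite -ler_norml -sqrtr_sqr ler_wsqrtr//.
  by apply: le_trans hz; rewrite lerDr.
Qed.

Lemma conorm_exhaustion p :
  (conorm (ddc F) p (fun u => dir u exhaustion p) <= 1)%E.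
Proof.
apply: ge_ereal_sup => _ [u /= um <-]; rewrite lee_fin.
rewrite /exhaustion (dir_coord_sum _ is_derive_ln1sqr).
apply: (@le_trans _ _ (\sum_(j < n) (n.+1%:R)^-1)); last first.
  by rewrite sumr_const card_ord -[_ *+ n]mulr_natl ler_pdivrMr// mul1r ler_nat.
apply: le_trans (ler_norm_sum _ _ _) _; apply: ler_sum => j _.
set h := 2 * _ / _.
(* Each summand of the metric is at most 1 on the unit ball. *)
have uj : (u.1 0 j) ^+ 2 * ddphi (real_part p 0 j) <= 1.
  apply: le_trans um; rewrite metric_ddc_psi (bigD1 j)//=.
  rewrite -[leLHS]addr0; apply: lerD.
    by apply: ler_wpM2r; [exact/ltW/ddphi_gt0|rewrite lerDl sqr_ge0].
  apply: sumr_ge0 => i _; apply: mulr_ge0; last exact/ltW/ddphi_gt0.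
  by rewrite addr_ge0 ?sqr_ge0.
have uh : `|u.1 0 j * h| <= 2.
  rewrite -(@ler_pXn2r _ 2)// ?nnegrE// real_normK ?num_real// exprMn.
  have := ler_wpM2l (sqr_ge0 (u.1 0 j)) (sqr_dln1sqr_le (real_part p 0 j)).
  rewrite -/h; lra.
rewrite -mulrA normrM ger0_norm ?invr_ge0 ?mulr_ge0// invfM mulrAC.
rewrite ler_piMl ?invr_ge0//; lra.
Qed.

Lemma complete_kahler_ddc_psi : complete_kahler (ddc F).
Proof.
split; first exact: kahler_ddc_psi.
exists exhaustion; split.
- exact: exhaustion_ge0.
- exact: smooth_exhaustion.
- by move=> c _; exact: compact_exhaustion.
- exact: conorm_exhaustion.
Qed.

End CylinderCalculus.

Theorem lemma7p1 (R : realType) (n : nat) :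
  [/\ strictly_convex (@psi R n),
      range (gradient (@psi R n)) `<=`
        [set p : 'rV[R]_n | forall j, -1 < p 0 j < constC R + 1] &
      complete_kahler (ddc (fun p : cylinder R n => psi (real_part p)))].
Proof.
split.
- exact: strictly_convex_psi.
- by move=> _ [x _ <-] j /=; rewrite gradient_psi mxE dphi_bounds.
- exact: complete_kahler_ddc_psi.
Qed.
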